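(* Let $p>2$ be a prime, $\xi$ a primitive element of $\mathbb{F}_p$, and let $f(x)\in\mathbb{F}_p[x]$ be the unique polynomial of degree at most $p-1$ with $f(0)=0$ and $f(\xi^i)=i+1$ (viewed as an element of $\mathbb{F}_p$) for $i=0,1,\ldots,p-2$. Then $$\deg(f)=w(f)=p-2,$$ $$Ind(f)=p-1\ \text{ if } p>3,$$ $$\mathcal{L}(f)<(2(p-2))^{1/2}+1,\qquad \mathcal{I}(f)<2(p-2)^{1/2}+1,$$ and $$Crk(f)>p-2(p-2)^{1/2}-1.$$
   Context: $w(f)$ denotes the weight of $f$, i.e. the number of its nonzero coefficients. Index: for a positive divisor $\ell$ of $p-1$, let $C_0=\{\xi^{k\ell}: k=0,\ldots,(p-1)/\ell-1\}$ and $C_i=\xi^iC_0$ for $i=0,\ldots,\ell-1$. For a positive integer $r$ and $a_0,\ldots,a_{\ell-1}\in\mathbb{F}_p^*$, the $r$-th order cyclotomic mapping of index $\ell$ sends $0\mapsto0$ and $x\mapsto a_ix^r$ for $x\in C_i$. For $f$ with $f(0)=0$, $Ind(f)$ is the smallest positive divisor $\ell$ of $p-1$ such that $f$ coincides on $\mathbb{F}_p$ with some $r$-th order cyclotomic mapping of index $\ell$. Linearity: $\mathcal{L}(f)=\max_{a\in\mathbb{F}_p^*}|\{c\in\mathbb{F}_p: f(c)=ac\}|$. Invertibility: $\mathcal{I}(f)=\max_{c\in\mathbb{F}_p^*}|\{x\in\mathbb{F}_p^*: f(x)=c/x\}|$. Carlitz rank: let $x^{p-2}$ denote the map $0\mapsto0$,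 $x\mapsto x^{-1}$ ($x\ne0$). $Crk(f)$ of a permutation polynomial $f$ is the smallest $n\ge0$ such that $f$ coincides on $\mathbb{F}_p$ with $P_n(x)=(\ldots((c_0x+c_1)^{p-2}+c_2)^{p-2}\ldots+c_n)^{p-2}+c_{n+1}$ for some $c_i\in\mathbb{F}_p$ with $c_i\neq0$ for $i=0,2,\ldots,n$.
   Formalization: The bounds on L(f) and Crk(f) are stated only for p > 3; both are false at p = 3, where f(x) = x has L(f) = 3 > √2 + 1 and Crk(f) = 0, which is not greater than p − 2(p−2)^{1/2} − 1 = 0. *)

(* Defs.v *)
From mathcomp Require Import all_boot all_order all_algebra.
From mathcomp Require Import boolp.

Set Implicit Arguments.
Unset Strict Implicit.
Unset Printing Implicit Defensive.

Import Order.TTheory GRing.Theory Num.Theory.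

Local Open Scope ring_scope.

(* Least natural number satisfying P; the default value 0 is used only when P
   is empty. *)
Definition least (P : nat -> Prop) : nat :=
  if pselect (exists n, `[< P n >]) is left exP then ex_minn exP else 0%N.

Definition weight (R : nzRingType) (f : {poly R}) : nat :=
  count (fun c => c != 0) f.

Definition cyclotomic_subgroup (p : nat) (xi : 'F_p) (l : nat) : {set 'F_p} :=
  [set xi ^+ (k * l) | k : 'I_(p.-1 %/ l)].

Definition cyclotomic_coset (p : nat) (xi : 'F_p) (l i : nat) : {set 'F_p} :=
  [set xi ^+ i * x | x in cyclotomic_subgroup xi l].

Definition cyclotomic_mapping (p : nat) (xi : 'F_p) (l r : nat)
    (g : 'F_p -> 'F_p) : Prop :=
  exists a : 'I_l -> 'F_p,
    [/\ forall i, a i != 0,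
        g 0 = 0 &
        forall (i : 'I_l) (x : 'F_p),
          x \in cyclotomic_coset xi l i -> g x = a i * x ^+ r].

Definition Ind (p : nat) (xi : 'F_p) (f : {poly 'F_p}) : nat :=
  least (fun l => [/\ (0 < l)%N, (l %| p.-1)%N &
    exists2 r, (0 < r)%N & cyclotomic_mapping xi l r (horner f)]).

Definition linearity (p : nat) (f : {poly 'F_p}) : nat :=
  \max_(a : 'F_p | a != 0%R) #|[set c : 'F_p | (f.[c] == a * c)%R]|.

Definition invertibility (p : nat) (f : {poly 'F_p}) : nat :=
  \max_(c : 'F_p | c != 0%R) #|[set x : 'F_p | ((x != 0) && (f.[x] == c / x))%R]|.

(* The map P_n, with P_0(x) = c_0 x + c_1 and P_n = P_{n-1}^{p-2} + c_{n+1}.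
   Since 0^-1 = 0 in MathComp, y^-1 is the map written y^{p-2}. *)
Fixpoint carlitz_chain (p : nat) (c : nat -> 'F_p) (n : nat) (x : 'F_p) : 'F_p :=
  if n is m.+1 then (carlitz_chain c m x)^-1 + c m.+2 else c 0%N * x + c 1%N.

(* Meaningful for permutation polynomials only: no other polynomial is induced
   by a chain, in which case the value is the default 0. *)
Definition Crk (p : nat) (f : {poly 'F_p}) : nat :=
  least (fun n => exists c : nat -> 'F_p,
    [/\ c 0%N != 0,
        forall i, (2 <= i <= n)%N -> c i != 0 &
        forall x, f.[x] = carlitz_chain c n x]).

(* Main.v *)
(* The coefficients of [f] are the Fourier transform of [i |-> i + 1] over the
   exponents modulo [p - 1], that is, arithmetico-geometric sums.

   If [f x] agrees at [x = xi^i] and at [xi^(i + d)] with the same Moebius map,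
   then eliminating the value [i + 1] leaves an equation of degree at most two
   for [xi^i] (degree one when the map is linear).  Hence the exponents [i] at
   which [f] agrees with a Moebius map form a ruler in which every distance
   occurs at most twice (once for linear maps).  The gaps between neighbours
   and between next-to-neighbours of such a ruler cannot be too small on
   average, which bounds its number of marks; a few small primes escape the
   estimate and are checked by computation.  This gives the bounds on the
   linearity and the invertibility, and on the Carlitz rank because a chain
   with [n] inversions agrees with a Moebius map off at most [n] points.
   Carlitz's theorem, that every permutation of F_p is such a chain, is needed
   for the rank not to take its junk value. *)

Require Import Defs.
From mathcomp Require Import all_boot all_order all_algebra.
From mathcomp Require Import all_fingroup all_field.
From mathcomp Require Import boolp zify ring lra.

Set Implicit Arguments.
Unset Strict Implicit.
Unset Printing Implicit Defensive.

Import Order.TTheory GRing.Theory Num.Theory.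

Local Open Scope ring_scope.

(** * Rulers whose distances have bounded multiplicity *)

(** Each entry satisfies [q <= x + (q - x)], and since every positive value occurs at most [r]
    times, the truncated differences [q - x] sum to at most [r] times 1 + ... + (q - 1). *)
Lemma sumn_multiplicity_bound (r q : nat) (s : seq nat) :
  0%N \notin s -> (forall d, (0 < d)%N -> (count_mem d s <= r)%N) ->
  (2 * (q * size s) <= 2 * sumn s + r * (q * q.-1))%N.
Proof.
move=> s0 sr.
have cut : (\sum_(x <- s) (q - x) <= r * 'C(q, 2))%N.
  have -> : (\sum_(x <- s) (q - x) =
             \sum_(v < q) \sum_(x <- s) (x == v) * (q - v))%N.
    rewrite exchange_big /=; apply: eq_bigr => x _.
    have [xq|qx] := ltnP x q.
      rewrite (bigD1 (Ordinal xq)) //= eqxx mul1n big1 ?addn0 // => v.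
      by rewrite -val_eqE /= eq_sym => /negbTE->.
    by rewrite big1 => [|v _]; [lia | case: eqP => // xv; have := ltn_ord v; lia].
  have occ v : (\sum_(x <- s) (x == v) * (q - v) = count_mem v s * (q - v))%N.
    by rewrite -big_distrl /= -sum1_count [in RHS]big_mkcond.
  under eq_bigr do rewrite occ.
  rewrite -bin2_sum big_mkord.
  case: {occ} q => [|q]; first by rewrite !big_ord0.
  rewrite !big_ord_recl (count_memPn s0) add0n big_distrr.
  rewrite [leqRHS](reindex_inj rev_ord_inj) /=.
  apply: leq_sum => v _; apply: leq_mul; first exact: sr.
  by rewrite /bump /=; have := ltn_ord v; lia.
have low : (q * size s <= sumn s + \sum_(x <- s) (q - x))%N.
  rewrite sumnE -big_split /= mulnC -sum1_size big_distrl /=.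
  by apply: leq_sum => x _; lia.
have := mul_bin_diag q 1; rewrite bin1.
by nia.
Qed.

Lemma count_leq_disjoint (T : eqType) (a1 a2 a : pred T) (s : seq T) :
  {in s, forall x, (a1 x + a2 x <= a x)%N} ->
  (count a1 s + count a2 s <= count a s)%N.
Proof.
elim: s => //= x s IHs le_a; have := le_a x (mem_head x s).
have /IHs : {in s, forall y, (a1 y + a2 y <= a y)%N}.
  by move=> y sy; apply: le_a; rewrite inE sy orbT.
by lia.
Qed.

(* The gaps between marks one and two steps apart are [2 n + 3] distances of
   total less than three times the length, each value occurring at most [r]
   times; [q] is a free truncation level to be optimised. *)
Lemma ruler_length_bound (r q B n : nat) (s : seq nat) :
  sorted ltn s -> all (leq^~ B) s -> size s = n.+3 ->
  (forall d, (0 < d)%N -> (count (fun i => (i + d)%N \in s) s <= r)%N) ->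
  (2 * (q * n.*2.+3) + 4 <= 6 * B + r * (q * q.-1))%N.
Proof.
move=> s_sorted /allP sB sz_s sr.
pose a := nth 0%N s.
have a_lt i j : (i < j < n.+3)%N -> (a i < a j)%N.
  case/andP=> ij jn; apply: (sorted_ltn_nth ltn_trans) => //;
  by rewrite inE sz_s // (ltn_trans ij).
have a_in i : (i < n.+3)%N -> a i \in s by move=> ?; rewrite mem_nth ?sz_s.
have aB i : (i < n.+3)%N -> (a i <= B)%N by move/a_in/sB.
pose gap1 := [seq (a k.+1 - a k)%N | k <- iota 0 n.+2].
pose gap2 := [seq (a k.+2 - a k)%N | k <- iota 0 n.+1].
have gap_gt0 : 0%N \notin gap1 ++ gap2.
  rewrite mem_cat negb_or; apply/andP; split; apply/mapP=> -[k];
    rewrite mem_iota /= add0n => kn; first by have := @a_lt k k.+1; lia.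
  by have := @a_lt k k.+2; lia.
have gap_r d : (0 < d)%N -> (count_mem d (gap1 ++ gap2) <= r)%N.
  move=> d_gt0; apply: leq_trans (sr d d_gt0).
  have countE P : count P s = count (fun k => P (a k)) (iota 0 n.+3).
    by rewrite -[in LHS](mkseq_nth 0%N s) sz_s count_map.
  rewrite count_cat !count_map countE.
  have -> : iota 0 n.+3 = iota 0 n.+1 ++ [:: n.+1; n.+2].
    by rewrite -[n.+3](addn2 n.+1) iotaD.
  have -> : iota 0 n.+2 = iota 0 n.+1 ++ [:: n.+1].
    by rewrite -[n.+2](addn1 n.+1) iotaD.
  rewrite !count_cat /= !addn0.
  have step k j : (k < j < n.+3)%N -> (a j - a k)%N == d -> (a k + d)%N \in s.
    move=> kj /eqP <-; rewrite subnKC; last exact/ltnW/a_lt.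
    by apply: a_in; case/andP: kj.
  pose P k := (a k + d)%N \in s.
  pose Q1 k := (a k.+1 - a k)%N == d; pose Q2 k := (a k.+2 - a k)%N == d.
  (* The two gaps starting at mark [k] differ, so at most one of them equals [d], and then [a k + d]
     is a mark: gaps of both kinds are charged to distinct [k]. *)
  have PQ : (count Q1 (iota 0 n.+1) + count Q2 (iota 0 n.+1)
             <= count P (iota 0 n.+1))%N.
    apply: count_leq_disjoint => k; rewrite mem_iota /= add0n => kn.
    have := @step k k.+1; have := @step k k.+2; have := @a_lt k.+1 k.+2.
    rewrite /Q1 /Q2 /P; move: (_ \in s) => b.
    by case: eqP; case: eqP; case: b => //=; lia.
  have Pn : (Q1 n.+1 <= P n.+1)%N.
    have := @step n.+1 n.+2; rewrite /Q1 /P; move: (_ \in s) => b.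
    by case: eqP; case: b => //=; lia.
  have : (count Q1 (iota 0 n.+1) + Q1 n.+1 + count Q2 (iota 0 n.+1) <=
          count P (iota 0 n.+1) + (P n.+1 + P n.+2))%N by lia.
  by [].
have gap1_sum : (sumn gap1 = a n.+2 - a 0)%N.
  rewrite sumnE big_map -[iota 0 _]/(index_iota 0 n.+2) telescope_sumn_in //.
  by move=> i /= ?; apply/ltnW/a_lt; lia.
have gap2_sum : (sumn gap2 = (a n.+2 - a 1) + (a n.+1 - a 0))%N.
  rewrite sumnE big_map -[iota 0 _]/(index_iota 0 n.+1).
  rewrite -(@telescope_sumn_in 0 n.+1 (fun k => a k.+1)) //; last first.
    by move=> i /= ?; apply/ltnW/a_lt; lia.
  rewrite -(@telescope_sumn_in 0 n.+1 a) //; last first.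
    by move=> i /= ?; apply/ltnW/a_lt; lia.
  rewrite -big_split /=; apply: eq_big_nat => i ?.
  by have := @a_lt i i.+1; have := @a_lt i.+1 i.+2; lia.
have := sumn_multiplicity_bound q gap_gt0 gap_r.
rewrite sumn_cat gap1_sum gap2_sum size_cat !size_map !size_iota.
have -> : (n.+2 + n.+1 = n.*2.+3)%N by lia.
(* As [a 1 >= 1] and [a n.+1 < B], the three telescoped lengths total at most [3 B - 2]; this is the
   source of the 4. *)
have a01 : (a 0 < a 1)%N by exact: a_lt.
have an12 : (a n.+1 < a n.+2)%N by apply: a_lt; rewrite !ltnS leqnn.
have anB : (a n.+2 <= B)%N by exact: aB.
by move: (q * _)%N (r * _)%N => x y; lia.
Qed.

(** * Exponents where the discrete logarithm meets a Moebius map *)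

Lemma prim_root_neq0 (R : nzRingType) (n : nat) (z : R) :
  n.-primitive_root z -> z != 0.
Proof.
move=> z_prim; apply/eqP=> z0; have := prim_expr_order z_prim.
move/eqP; rewrite z0 expr0n eqn0Ngt (prim_order_gt0 z_prim) /=.
by rewrite eq_sym oner_eq0.
Qed.

Lemma Fp_natr_eq0 (p n : nat) :
  prime p -> ((n%:R : 'F_p) == 0) = (p %| n)%N.
Proof. by move=> p_pr; rewrite (dvdn_pcharf (pchar_Fp p_pr)). Qed.

Lemma Fp_small_natr_neq0 (p n : nat) :
  prime p -> (0 < n < p)%N -> (n%:R : 'F_p) != 0.
Proof. by move=> p_pr /andP[n0 np]; rewrite Fp_natr_eq0 // gtnNdvd. Qed.

(** Incidence with (al x + be) / (ga x + de) at x = xi^i, the denominator being cleared; a pole is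
    no hit when the determinant is nonzero. *)
Definition moebius_hits (p : nat) (xi al be ga de : 'F_p) : seq nat :=
  [seq i <- iota 0 p.-1 |
    i.+1%:R * (ga * xi ^+ i + de) == al * xi ^+ i + be].

(* For a fixed shift [d], eliminating [i] from the two incidence relations
   leaves an equation of degree at most two for [xi ^+ i]. *)
Lemma moebius_hits_shift (p : nat) (xi al be ga de : 'F_p) (d : nat) :
  prime p -> (p.-1).-primitive_root xi -> al * de - be * ga != 0 -> (0 < d)%N ->
  (count (fun i => (i + d)%N \in moebius_hits xi al be ga de)
     (moebius_hits xi al be ga de) <= (ga != 0%R).+1)%N.
Proof.
move=> p_pr xi_prim det_neq0 d_gt0; set S := moebius_hits _ _ _ _ _.
have in_S i : i \in S = (i < p.-1)%N &&
    (i.+1%:R * (ga * xi ^+ i + de) == al * xi ^+ i + be).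
  by rewrite mem_filter mem_iota /= add0n andbC.
rewrite -size_filter; set T := filter _ _.
have in_T i : i \in T = ((i + d)%N \in S) && (i \in S) by rewrite mem_filter.
(* If some [i] lies in [T], then [i + d < p - 1], so [d] is nonzero in the field. *)
have [->|[i0 i0T]] : T = [::] \/ exists i, i \in T.
- by case: (T) => [|i t]; [left | right; exists i; exact: mem_head].
- by [].
have d_lt : (d < p)%N.
  by move: i0T; rewrite in_T !in_S; lia.
have dN0 : (d%:R : 'F_p) != 0 by rewrite Fp_small_natr_neq0 ?d_gt0.
set y := xi ^+ d.
have xi_neq0 : xi != 0 by exact: prim_root_neq0 xi_prim.
have yN0 : y != 0 by rewrite expf_neq0 // xi_neq0.
(* Coefficients of d (ga x y + de) (ga x + de) - (al de - be ga) x (y - 1), which remains after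
   eliminating [i + 1]. *)
pose c0 := d%:R * de ^+ 2.
pose c1 := d%:R * ga * de * (y + 1) - (al * de - be * ga) * (y - 1).
pose c2 := d%:R * ga ^+ 2 * y.
pose Q : {poly 'F_p} := Poly (if ga == 0 then [:: c0; c1] else [:: c0; c1; c2]).
have Q_val x : Q.[x] = c0 + c1 * x + c2 * x ^+ 2.
  rewrite horner_Poly /c2; case: eqP => [->|_] /=; ring.
(* If [ga = 0], then [de] is nonzero and the constant term survives; otherwise the quadratic term
   does. *)
have QN0 : Q != 0.
  apply/eqP=> Q0.
  have := congr1 (fun P : {poly 'F_p} => P`_0) Q0.
  have := congr1 (fun P : {poly 'F_p} => P`_2) Q0.
  rewrite /Q !coef_Poly !coef0; move: det_neq0.
  case: (eqVneq ga 0) => [->|gaN0] /= det_neq0.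
    move=> _ /eqP; rewrite /c0 mulf_eq0 (negbTE dN0) expf_eq0 /= => /eqP de0.
    by move: det_neq0; rewrite de0 !mulr0 subrr eqxx.
  have c2N0 : c2 != 0 by rewrite !mulf_neq0 ?expf_neq0.
  by move/eqP; rewrite (negbTE c2N0).
have Q_size : (size Q <= (ga != 0%R).+2)%N.
  by apply: leq_trans (size_Poly _) _; case: eqP.
rewrite -ltnS -(size_map (fun i => xi ^+ i)); apply: leq_trans Q_size.
apply: max_poly_roots => //.
  apply/allP=> _ /mapP[i + ->]; rewrite in_T !in_S.
  case/andP=> /andP[_ /eqP e1] /andP[_ /eqP e2]; rewrite rootE Q_val.
  move: e1 e2; rewrite -addSn natrD exprD -/y; set x := xi ^+ i; set u := _%:R.
  move=> e1 e2; apply/eqP.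
  transitivity (((u + d%:R) * (ga * (x * y) + de) - (al * (x * y) + be)) * (ga * x + de)
    - (u * (ga * x + de) - (al * x + be)) * (ga * (x * y) + de)).
    by rewrite /c0 /c1 /c2; ring.
  by rewrite e1 e2 !subrr !mul0r subrr.
rewrite map_inj_in_uniq; first by rewrite !filter_uniq // iota_uniq.
move=> i j; rewrite !in_T !in_S => /and3P[_ i_lt _] /and3P[_ j_lt _].
by move/eqP; rewrite (eq_prim_root_expr xi_prim) !modn_small // => /eqP.
Qed.

(** * Counting hits by computation *)

Lemma Fp_val_ltn (p : nat) (x : 'F_p) : prime p -> (nat_of_ord x < p)%N.
Proof. by move=> p_pr; have := ltn_ord x; rewrite [ltnRHS]Fp_cast. Qed.

(** The case [be = 0] in natural numbers, with [w] in place of [xi], so that it can be evaluated. *)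
Definition count_hits_mod (p w a g d : nat) : nat :=
  count (fun i => let t := iter i (fun t => t * w %% p)%N 1%N in
                  i.+1 * (g * t + d) == a * t %[mod p])%N (iota 0 p.-1).

Lemma size_moebius_hits (p : nat) (xi al ga de : 'F_p) :
  prime p ->
  size (moebius_hits xi al 0%R ga de) = count_hits_mod p xi al ga de.
Proof.
move=> p_pr; rewrite size_filter; apply: eq_count => i /=.
set t := iter _ _ _.
have xi_i : xi ^+ i = t%:R.
  rewrite {}/t; elim: i => //= i IHi.
  by rewrite (Fp_nat_mod p_pr) natrM natr_Zp -IHi exprSr.
have val_natr n : nat_of_ord (n%:R : 'F_p) = (n %% p)%N by exact: val_Fp_nat.
rewrite xi_i addr0 -{1}(natr_Zp ga) -{1}(natr_Zp de) -{1}(natr_Zp al).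
by rewrite -!natrM -natrD -natrM -val_eqE /= !val_natr.
Qed.

(** Here [w] runs over all nonzero residues and [de] is scaled to 1, so that [gs] lists the ratios
    [ga / de]. *)
Definition count_hits_bounded (p k : nat) (gs : seq nat) : bool :=
  all (fun w => all (fun g => all (fun a =>
    count_hits_mod p w a g 1 <= k)%N (iota 1 p.-1)) gs) (iota 1 p.-1).

Lemma moebius_hits_scale (p : nat) (xi al be ga de c : 'F_p) :
  c != 0 ->
  moebius_hits xi (c * al) (c * be) (c * ga) (c * de) =
  moebius_hits xi al be ga de.
Proof.
move=> c_neq0; apply: eq_filter => i /=.
rewrite -!mulrA -!mulrDr [_%:R * (c * _)]mulrCA.
by rewrite (inj_eq (mulfI c_neq0)).
Qed.

Lemma moebius_hits_compute (p k : nat) (xi al ga de : 'F_p) (gs : seq nat) :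
  prime p -> count_hits_bounded p k gs -> xi != 0 -> al != 0 -> de != 0 ->
  nat_of_ord (ga / de) \in gs ->
  (size (moebius_hits xi al 0%R ga de) <= k)%N.
Proof.
move=> p_pr /allP bnd xi0 al0 de0 ga_gs.
have range (x : 'F_p) : x != 0 -> nat_of_ord x \in iota 1 p.-1.
  move=> x0; rewrite -(inj_eq val_inj) in x0; rewrite mem_iota lt0n
    x0 add1n prednK ?prime_gt0 //.
  exact: Fp_val_ltn.
rewrite -(@moebius_hits_scale _ _ al 0 ga de de^-1) ?invr_eq0 //.
rewrite mulr0 mulVf // size_moebius_hits //.
have /allP/(_ _ ga_gs)/allP := bnd _ (range _ xi0).
rewrite [_^-1 * ga]mulrC; apply.
  by apply: range; rewrite mulf_neq0 ?invr_eq0.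
Qed.

(** * Bounds on the number of hits *)

Lemma moebius_hits_ruler (p : nat) (xi al be ga de : 'F_p) (q n : nat) :
  prime p -> (p.-1).-primitive_root xi -> al * de - be * ga != 0 ->
  size (moebius_hits xi al be ga de) = n.+3 ->
  (2 * (q * n.*2.+3) + 4 <= 6 * (p - 2) + (ga != 0%R).+1 * (q * q.-1))%N.
Proof.
move=> p_pr xi_prim det_neq0 sz_hits.
apply: ruler_length_bound sz_hits _ => [||d d_gt0].
- by apply: sorted_filter; [exact: ltn_trans | exact: iota_ltn_sorted].
- by apply/allP=> i; rewrite mem_filter mem_iota; lia.
- exact: moebius_hits_shift.
Qed.

Lemma linear_hits_bound (p : nat) (xi al : 'F_p) :
  prime p -> (3 < p)%N -> (p.-1).-primitive_root xi -> al != 0 ->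
  (size (moebius_hits xi al 0%R 0%R 1%R) ^ 2 < 2 * (p - 2))%N.
Proof.
move=> p_pr p_gt3 xi_prim al0.
have xi0 := prim_root_neq0 xi_prim.
have [n3|n3] := leqP 3 (size (moebius_hits xi al 0%R 0%R 1%R)); last first.
  move: n3; set N := size _; have : (4 < p)%N.
    by case: (ltngtP p 4) p_pr => // [|->//]; lia.
  by nia.
set N := size _ in n3 *; pose n := (N - 3)%N.
(* Taking for [q] the number of gaps maximises [2 q (2 n + 3) - q (q - 1)], the multiplicity being
   one. *)
have := @moebius_hits_ruler p xi al 0 0 1 n.*2.+3 n p_pr xi_prim.
rewrite mulr1 mul0r subr0 al0 eqxx => /(_ isT) ruler.
have {ruler} : ((2 * n + 3) * (n + 2) + 2 <= 3 * (p - 2))%N.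
  by have := ruler ltac:(rewrite -/N /n; lia); nia.
have -> : N = (n + 3)%N by rewrite /n; lia.
rewrite ltnNge => bnd; apply/negP => small.
(* Together with [small], the ruler bound gives n^2 <= 4 n + 11. *)
have n5 : (n <= 5)%N by nia.
have compute k : count_hits_bounded p k [:: 0] -> (n + 3 <= k)%N.
  move=> chk; have -> : (n + 3 = N)%N by rewrite /n; lia.
  by apply: (moebius_hits_compute p_pr chk); rewrite ?oner_neq0.
(* The composite values of [p] between the two bounds for [n <= 5]. The primes left are 5, 13 and
   19, where computation allows only [n + 2] hits. *)
have composite : all (fun m => p != m)
    [:: 6; 8; 9; 10; 12; 14; 18; 20; 25; 26; 33; 34]%N.
  apply/allP=> m m_comp; apply: contraTneq p_pr => ->.
  by move: m m_comp; apply/allP.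
have : [\/ p = 5 /\ n = 0, p = 13 /\ n = 2 | p = 19 /\ n = 3]%N.
  move: composite bnd small; rewrite /= !andbA; do 11!case/andP.
  move: n n5 {compute} => m.
  case: m => [|[|[|[|[|[|m]]]]]] //; move=> *;
    first [apply: Or31; lia | apply: Or32; lia | apply: Or33; lia | exfalso; lia].
case=> -[p_eq n_eq]; move: compute; rewrite p_eq n_eq.
- have chk : count_hits_bounded 5 2 [:: 0] by vm_compute.
  by move/(_ _ chk).
- have chk : count_hits_bounded 13 4 [:: 0] by vm_compute.
  by move/(_ _ chk).
- have chk : count_hits_bounded 19 5 [:: 0] by vm_compute.
  by move/(_ _ chk).
Qed.

(** For N = n + 3 hits and multiplicity two the best truncation level is [q = n + 2], and the ruler
    bound becomes (N - 1)^2 + 2 <= 3 (p - 2). *)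
Lemma moebius_hits_bound (p : nat) (xi al be ga de : 'F_p) :
  prime p -> (2 < p)%N -> (p.-1).-primitive_root xi -> al * de - be * ga != 0 ->
  ((size (moebius_hits xi al be ga de)).-1 ^ 2 < 4 * (p - 2))%N.
Proof.
move=> p_pr p_gt2 xi_prim det_neq0.
have [n3|n3] := leqP 3 (size (moebius_hits xi al be ga de)); last by nia.
move: n3; set N := size _ => n3; pose n := (N - 3)%N.
have sz_hits : N = n.+3 by rewrite /n; lia.
have := moebius_hits_ruler n.+2 p_pr xi_prim det_neq0 sz_hits.
rewrite sz_hits; case: (ga != 0) => /=; nia.
Qed.

(* Beyond the ruler bound, primality leaves only [p = 11]. *)
Lemma moebius0_hits_bound (p : nat) (xi al ga de : 'F_p) :
  prime p -> (3 < p)%N -> (p.-1).-primitive_root xi -> al * de != 0 ->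
  ((size (moebius_hits xi al 0%R ga de)) ^ 2 < 4 * (p - 2))%N.
Proof.
move=> p_pr p_gt3 xi_prim; rewrite mulf_eq0 negb_or => /andP[al0 de0].
have xi0 := prim_root_neq0 xi_prim.
have [n3|n3] := leqP 3 (size (moebius_hits xi al 0%R ga de)); last by nia.
move: n3; set N := size _ => n3; pose n := (N - 3)%N.
have sz_hits : N = n.+3 by rewrite /n; lia.
have det_neq0 : al * de - 0 * ga != 0 by rewrite mul0r subr0 mulf_neq0.
have ruler : (n.+2 * n.+2 + 2 <= 3 * (p - 2))%N.
  have := moebius_hits_ruler n.+2 p_pr xi_prim det_neq0 sz_hits.
  by case: (ga != 0) => /=; nia.
rewrite ltnNge sz_hits; apply/negP => small.
(* The two bounds give n^2 <= 2 n + 3, and for n = 0, 1, 2, 3 they leave only p = 4, 6, 8, 11. *)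
have n3' : (n <= 3)%N by nia.
have composite : all (fun m => p != m) [:: 4; 6; 8]%N.
  apply/allP=> m m_comp; apply: contraTneq p_pr => ->.
  by move: m m_comp; apply/allP.
have [p_eq n_eq] : (p = 11 /\ n = 3)%N.
  move: composite ruler small; rewrite /= !andbA; do 2!case/andP.
  by case: (n) n3' => [|[|[|[|m]]]] //; lia.
have chk : count_hits_bounded p 5 (iota 0 11) by rewrite p_eq; vm_compute.
have ga_small : nat_of_ord (ga / de) \in iota 0 11.
  by rewrite mem_iota -p_eq Fp_val_ltn.
have := moebius_hits_compute p_pr chk xi0 al0 de0 ga_small.
by rewrite -/N sz_hits n_eq.
Qed.

(** * Linearity and invertibility *)

Lemma prim_root_Fp_log (p : nat) (xi x : 'F_p) :
  prime p -> (p.-1).-primitive_root xi -> x != 0 ->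
  exists2 i, (i < p.-1)%N & x = xi ^+ i.
Proof.
move=> p_pr xi_prim x0; have x_unity : x ^+ p.-1 = 1.
  apply: (mulfI x0); rewrite mulr1 -exprS prednK ?prime_gt0 //.
  by rewrite -[RHS]expf_card card_Fp.
by have [i ->] := prim_rootP xi_prim x_unity; exists i.
Qed.

Lemma card_moebius_values (p : nat) (xi al be ga de : 'F_p) (f : {poly 'F_p}) :
  prime p -> (p.-1).-primitive_root xi ->
  (forall i, (i < p.-1)%N -> f.[xi ^+ i] = i.+1%:R) ->
  (#|[set x | (x != 0%R) && (f.[x] * (ga * x + de) == al * x + be)%R]|
    <= size (moebius_hits xi al be ga de))%N.
Proof.
move=> p_pr xi_prim fxi; rewrite -(size_map (fun i => xi ^+ i)).
apply: leq_trans (card_size _); apply/subset_leq_card/subsetP=> x.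
rewrite inE => /andP[/(prim_root_Fp_log p_pr xi_prim)[i i_lt ->]].
rewrite fxi // => hit; apply: map_f.
by rewrite mem_filter hit mem_iota.
Qed.

Lemma linearity_bound (p : nat) (xi : 'F_p) (f : {poly 'F_p}) (m : nat) :
  prime p -> (p.-1).-primitive_root xi ->
  (forall i, (i < p.-1)%N -> f.[xi ^+ i] = i.+1%:R) -> (0 < m)%N ->
  (forall a, a != 0 -> (size (moebius_hits xi a 0%R 0%R 1%R) ^ 2 < m)%N) ->
  ((linearity f).-1 ^ 2 < m)%N.
Proof.
move=> p_pr xi_prim fxi m_gt0 hits_m; rewrite /linearity.
elim/big_ind: _ => [//|k l|a a0]; first by case: (leqP k l).
apply: leq_ltn_trans (hits_m a a0); rewrite leq_sqr.
apply: leq_trans (card_moebius_values a 0 0 1 p_pr xi_prim fxi).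
(* The point 0 has no exponent and is set aside, which accounts for the predecessor. *)
pose A := [set c : 'F_p | f.[c] == a * c]; apply: (@leq_trans #|A :\ 0%R|).
  rewrite -/A (cardsD1 (0%R : 'F_p) A).
  by case: (_ \in A) => //=; exact: leq_pred.
apply/subset_leq_card/subsetP=> x; rewrite !inE mul0r add0r mulr1 addr0.
by case/andP=> -> ->.
Qed.

Lemma invertibility_bound (p : nat) (xi : 'F_p) (f : {poly 'F_p}) (m : nat) :
  prime p -> (p.-1).-primitive_root xi ->
  (forall i, (i < p.-1)%N -> f.[xi ^+ i] = i.+1%:R) -> (0 < m)%N ->
  (forall c, c != 0 -> ((size (moebius_hits xi 0%R c 1%R 0%R)).-1 ^ 2 < m)%N) ->
  ((invertibility f).-1 ^ 2 < m)%N.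
Proof.
move=> p_pr xi_prim fxi m_gt0 hits_m; rewrite /invertibility.
elim/big_ind: _ => [//|k l|c c0]; first by case: (leqP k l).
apply: leq_ltn_trans (hits_m c c0); rewrite leq_sqr -!subn1 leq_sub2r //.
(* Here 0 is already excluded; the predecessor comes from the bound on hits. *)
apply: leq_trans (card_moebius_values 0 c 1 0 p_pr xi_prim fxi).
apply/subset_leq_card/subsetP=> x; rewrite !inE => /andP[x0 /eqP->].
by rewrite x0 mul1r mul0r add0r addr0 divfK // eqxx.
Qed.

(** * Square roots in a real closed field *)

Lemma ltr_nat_sqrt (R : rcfType) (k m : nat) :
  (k ^ 2 < m)%N -> k%:R < Num.sqrt m%:R :> R.
Proof.
move=> km; have m_gt0 : (0 < m)%N by apply: leq_ltn_trans km.
rewrite -[ltLHS]ger0_norm ?ler0n // -sqrtr_sqr ltr_sqrt ?ltr0n //.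
by rewrite -natrX ltr_nat.
Qed.

Lemma ltr_nat_double_sqrt (R : rcfType) (k m : nat) :
  (k ^ 2 < 4 * m)%N -> k%:R < 2 * Num.sqrt m%:R :> R.
Proof.
move/(ltr_nat_sqrt R); rewrite natrM sqrtrM ?ler0n //.
by rewrite (natrX R 2 2) sqrtr_sqr ger0_norm ?ler0n.
Qed.

Lemma ltr_nat_pred (R : numDomainType) (k : nat) (x : R) :
  k.-1%:R < x -> k%:R < x + 1.
Proof.
move=> kx; apply: (@le_lt_trans _ _ k.-1.+1%:R).
  by rewrite ler_nat leqSpred.
by rewrite -natr1 ltrD2r.
Qed.

(** * Coefficients by Fourier inversion; degree and weight *)

Lemma arithmetico_geometric_sum (R : comNzRingType) (z : R) (n : nat) :
  (1 - z) * \sum_(i < n) i.+1%:R * z ^+ i =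
  \sum_(i < n) z ^+ i - n%:R * z ^+ n.
Proof.
elim: n => [|n IHn]; first by rewrite !big_ord0 mulr0 mul0r subr0.
rewrite !big_ord_recr /= mulrDr IHn -natr1 exprS; ring.
Qed.

Lemma geometric_sum_eq0 (F : idomainType) (w : F) (n : nat) :
  w ^+ n = 1 -> w != 1 -> \sum_(i < n) w ^+ i = 0.
Proof.
move=> wn w1; have := subrX1 w n; rewrite wn subrr => /esym/eqP.
by rewrite mulf_eq0 subr_eq0 (negbTE w1) => /eqP.
Qed.

Lemma Fp_natr_pred (p : nat) : prime p -> (p.-1%:R : 'F_p) = -1.
Proof.
move=> p_pr; apply/eqP; rewrite -addr_eq0 natr1 prednK ?prime_gt0 //.
by rewrite Fp_natr_eq0.
Qed.

(** Orthogonality of characters of a cyclic group whose order p - 1 is -1 in the field. The indices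
    0 and p - 1 give the same character; the vanishing constant term tells them apart. *)
Lemma coef_from_values (p : nat) (xi : 'F_p) (f : {poly 'F_p}) (j : nat) :
  prime p -> (p.-1).-primitive_root xi -> (size f <= p)%N -> f`_0 = 0 ->
  (0 < j < p)%N ->
  \sum_(i < p.-1) f.[xi ^+ i] * (xi ^+ j)^-1 ^+ i = - f`_j.
Proof.
move=> p_pr xi_prim sz_f f_0 /andP[j_gt0 j_lt].
have xi0 := prim_root_neq0 xi_prim.
have xij0 : xi ^+ j != 0 by rewrite expf_neq0.
transitivity (\sum_(k < p) f`_k * \sum_(i < p.-1) (xi ^+ k / xi ^+ j) ^+ i).
  under eq_bigr do rewrite (horner_coef_wide _ sz_f) mulr_suml.
  rewrite exchange_big /=; apply: eq_bigr => k _; rewrite mulr_sumr.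
  by apply: eq_bigr => i _; rewrite exprMn [xi ^+ k ^+ i]exprAC mulrA.
rewrite (bigD1 (Ordinal j_lt)) //= [X in _ + X]big1 ?addr0 => [|k].
  rewrite divff //; under eq_bigr do rewrite expr1n.
  by rewrite sumr_const card_ord Fp_natr_pred // mulrN1.
rewrite -val_eqE /= => kj; case: (posnP k) => [->|k_gt0].
  by rewrite f_0 mul0r.
rewrite geometric_sum_eq0 ?mulr0 //.
  rewrite exprMn exprVn ![_ ^+ _ ^+ p.-1]exprAC (prim_expr_order xi_prim).
  by rewrite !expr1n divr1.
apply: contraNneq kj => /(congr1 (fun y => y * xi ^+ j)).
rewrite divfK // mul1r => /eqP; rewrite (eq_prim_root_expr xi_prim).
(* Both indices lie between 1 and p - 1, so lowering them by one turns congruence modulo p - 1 into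
   equality. *)
have k_lt := ltn_ord k.
have := eqn_modDr 1 k.-1 j.-1 p.-1; rewrite !addn1 !prednK // => ->.
by rewrite !modn_small; lia.
Qed.

(** The coefficient of index [j] is minus the sum of (i + 1) z^i with z = xi^(-j). For j = p - 1
    this sum is p (p - 1) / 2, a multiple of p; for the indices in between, z is not 1 and the sum
    times 1 - z is 1. *)
Lemma discrete_log_poly_coefs (p : nat) (xi : 'F_p) (f : {poly 'F_p}) :
  prime p -> (2 < p)%N -> (p.-1).-primitive_root xi -> (size f <= p)%N ->
  f.[0] = 0 -> (forall i, (i < p.-1)%N -> f.[xi ^+ i] = i.+1%:R) ->
  [/\ f`_0 = 0, f`_p.-1 = 0 & forall j, (0 < j < p.-1)%N -> f`_j != 0].
Proof.
move=> p_pr p_gt2 xi_prim sz_f f0 fxi.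
have f_0 : f`_0 = 0 by rewrite -horner_coef0.
have coefE j : (0 < j < p)%N ->
    f`_j = - \sum_(i < p.-1) i.+1%:R * (xi ^+ j)^-1 ^+ i.
  move=> j_range; rewrite -[LHS]opprK -(coef_from_values p_pr xi_prim) //.
  by congr (- _); apply: eq_bigr => i _; rewrite fxi.
split=> // [|j /andP[j_gt0 j_lt]].
  rewrite coefE; last by lia.
  rewrite (prim_expr_order xi_prim) invr1.
  under eq_bigr do rewrite expr1n mulr1.
  apply/eqP; rewrite oppr_eq0 -natr_sum Fp_natr_eq0 //.
  have -> n : (\sum_(i < n) i.+1 = 'C(n.+1, 2))%N.
    by rewrite -bin2_sum big_mkord big_ord_recl add0n.
  rewrite prednK ?prime_gt0 //.
  by apply: prime_dvd_bin => //; lia.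
rewrite coefE; last by lia.
set z := _^-1; rewrite oppr_eq0.
have z_unity : z ^+ p.-1 = 1.
  by rewrite /z exprVn exprAC (prim_expr_order xi_prim) expr1n invr1.
have z1 : z != 1.
  rewrite invr_eq1 -(prim_order_dvd xi_prim); apply/negP=> /dvdn_leq.
  by move/(_ j_gt0); lia.
have := arithmetico_geometric_sum z p.-1.
rewrite geometric_sum_eq0 // z_unity mulr1 sub0r Fp_natr_pred // opprK.
by apply: contra_eq_neq => ->; rewrite mulr0 eq_sym oner_eq0.
Qed.

Lemma size_weight_from_coefs (R : nzRingType) (f : {poly R}) (m : nat) :
  (size f <= m.+2)%N -> f`_0 = 0 -> f`_m.+1 = 0 -> (0 < m)%N ->
  (forall j, (0 < j <= m)%N -> f`_j != 0) ->
  size f = m.+1 /\ weight f = m.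
Proof.
move=> sz_f f_0 f_m1 m_gt0 f_neq0.
have sz : size f = m.+1.
  apply/eqP; rewrite eqn_leq; apply/andP; split.
    apply/leq_sizeP=> j; rewrite leq_eqVlt => /predU1P[<- //|mj].
    by apply: nth_default; apply: leq_trans mj.
  rewrite ltnNge; apply: contra (f_neq0 m _); last by rewrite m_gt0 leqnn.
  by move=> ?; rewrite nth_default.
split=> //; rewrite /weight -(mkseq_nth 0 f) sz count_map /= f_0 eqxx add0n.
transitivity (size (iota 1 m)); last by rewrite size_iota.
apply/eqP; rewrite -all_count; apply/allP=> j; rewrite mem_iota /= => j_range.
by apply: f_neq0; lia.
Qed.

(** * The index *)

Lemma leastP (P : nat -> Prop) :
  (exists n, P n) -> P (least P) /\ (forall n, P n -> (least P <= n)%N).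
Proof.
move=> [n0 Pn0]; rewrite /least; case: pselect => [exP|[]]; last first.
  by exists n0; apply/asboolP.
case: ex_minnP => m /asboolP Pm m_min; split=> // n Pn.
by apply: m_min; apply/asboolP.
Qed.

(** The exponents [j] and [j + l] agree modulo [l], so both points lie in one coset and share its
    multiplier. *)
Lemma cyclotomic_mapping_shift (p : nat) (xi : 'F_p) (l r : nat)
    (g : 'F_p -> 'F_p) (j : nat) :
  cyclotomic_mapping xi l r g -> (0 < l)%N -> (l %| p.-1)%N ->
  (j + l < p.-1)%N ->
  g (xi ^+ (j + l)) = g (xi ^+ j) * xi ^+ (l * r).
Proof.
move=> [a [_ _ ga]] l_gt0 /dvdnP[m p_ml] jl_lt.
pose i := Ordinal (ltn_pmod j l_gt0).
have quo_lt : ((j %/ l).+1 < p.-1 %/ l)%N.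
  rewrite p_ml mulnK // -(ltn_pmul2r l_gt0) -p_ml; apply: leq_ltn_trans jl_lt.
  by rewrite mulSn addnC leq_add2r leq_divM.
have in_coset k : (k < p.-1 %/ l)%N ->
    xi ^+ (k * l + j %% l) \in cyclotomic_coset xi l i.
  move=> k_lt; rewrite addnC exprD; apply: imset_f.
  exact: (imset_f (fun k : 'I_(p.-1 %/ l) => xi ^+ (k * l)) (x := Ordinal k_lt)).
have jE : j = (j %/ l * l + j %% l)%N := divn_eq j l.
have jlE : (j + l = (j %/ l).+1 * l + j %% l)%N by rewrite mulSn {1}jE; lia.
rewrite jlE (ga i) ?in_coset // -jlE.
rewrite [in RHS]jE (ga i) ?in_coset ?(ltn_trans _ quo_lt) // -jE.
by rewrite -mulrA -!exprM -exprD mulnDl.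
Qed.

(** For l = p - 1 every coset is a single point. For a proper divisor, shifting the exponents 0 and
    1 by [l] would give l + 1 = s and l + 2 = 2 s with s = xi^(l r), hence l = 0 in the field. *)
Lemma Ind_discrete_log (p : nat) (xi : 'F_p) (f : {poly 'F_p}) :
  prime p -> (3 < p)%N -> (p.-1).-primitive_root xi -> f.[0] = 0 ->
  (forall i, (i < p.-1)%N -> f.[xi ^+ i] = i.+1%:R) ->
  Ind xi f = p.-1.
Proof.
move=> p_pr p_gt3 xi_prim f0 fxi; have xi0 := prim_root_neq0 xi_prim.
have p1_gt0 : (0 < p.-1)%N by lia.
pose P l := [/\ (0 < l)%N, (l %| p.-1)%N &
  exists2 r, (0 < r)%N & cyclotomic_mapping xi l r (horner f)].
have full : P p.-1.
  split=> //; exists 1%N => //; exists (fun i => i.+1%:R / xi ^+ i).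
  split=> // [i|i x /imsetP[_ /imsetP[k _ ->] ->]].
    rewrite mulf_neq0 ?invr_eq0 ?expf_neq0 // Fp_small_natr_neq0 //=.
    by have := ltn_ord i; lia.
  have -> : nat_of_ord k = 0%N.
    have : (k < 1)%N by rewrite (leq_trans (ltn_ord k)) // divnn p1_gt0.
    by case: (nat_of_ord k).
  by rewrite mul0n mulr1 fxi // expr1 divfK ?expf_neq0.
have [] := leastP (ex_intro P _ full); rewrite -[least P]/(Ind xi f).
move: (Ind xi f) => l [l_gt0 l_dvd [r _ f_cyc]] /(_ _ full) l_le.
apply/eqP; rewrite eqn_leq l_le leqNgt; apply/negP=> l_lt.
(* With [p > 3], this keeps the shifted exponent [1 + l] below p - 1. *)
have l_half : (l.*2 <= p.-1)%N.
  case/dvdnP: l_dvd l_lt => m ->; case: m => [|[|m]]; rewrite ?mul1n ?ltnn //.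
  by move=> _; rewrite -mul2n leq_mul2r orbT.
have : f.[xi ^+ (0 + l)] = f.[xi ^+ 0] * xi ^+ (l * r).
  by apply: cyclotomic_mapping_shift; rewrite // add0n.
rewrite !fxi // ?add0n // mul1r => xi_lr.
have : f.[xi ^+ (1 + l)] = f.[xi ^+ 1] * xi ^+ (l * r).
  by apply: cyclotomic_mapping_shift => //; lia.
rewrite !fxi; try lia.
rewrite -xi_lr add1n -(natr1 l.+1) -(natr1 l) => /eqP.
rewrite -subr_eq0.
have -> : l%:R + 1 + 1 - 2 * (l%:R + 1) = - l%:R :> 'F_p by ring.
by rewrite oppr_eq0 (negbTE (Fp_small_natr_neq0 p_pr _)) //; lia.
Qed.

(** * Carlitz chains and Carlitz rank *)

Definition carlitz_rep (p : nat) (g : 'F_p -> 'F_p) (n : nat)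
    (c : nat -> 'F_p) : Prop :=
  [/\ c 0%N != 0, forall i, (2 <= i <= n)%N -> c i != 0 &
      forall x, g x = carlitz_chain c n x].

Lemma eq_carlitz_chain (p : nat) (c c' : nat -> 'F_p) (n : nat) (x : 'F_p) :
  (forall i, (i <= n.+1)%N -> c i = c' i) ->
  carlitz_chain c n x = carlitz_chain c' n x.
Proof.
elim: n => [|n IHn] cc' /=; first by rewrite !cc'.
by rewrite IHn ?cc' // => i i_le; apply: cc'; apply: leqW.
Qed.

(** A new inversion cancels the last one when the constant between them is zero. Otherwise it is
    appended: the constant before it is nonzero, or is [c 1], which may vanish. *)
Lemma carlitz_rep_inv (p : nat) (g : 'F_p -> 'F_p) (n : nat) (c : nat -> 'F_p) :
  carlitz_rep g n c ->
  exists m c', carlitz_rep (fun x => (g x)^-1) m c'.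
Proof.
move=> [c0 c_neq0 gE].
have [/andP[n_gt0 /eqP c_last]|c_last] := boolP ((0 < n)%N && (c n.+1 == 0)).
  case: n n_gt0 c_last c_neq0 gE => // n _ c_last c_neq0 gE.
  exists n, c; split=> // [i i_range|x]; first by apply: c_neq0; lia.
  by rewrite gE /= c_last addr0 invrK.
pose c' i := if i == n.+2 then 0 else c i.
exists n.+1, c'; split=> // [i i_range|x].
  rewrite /c' ifN; last by lia.
  case: (eqVneq i n.+1) => [->|]; last by move=> ?; apply: c_neq0; lia.
  by move: c_last; rewrite negb_and; case/orP=> //; lia.
rewrite /= {2}/c' eqxx addr0 gE; congr (_^-1); apply: eq_carlitz_chain => i i_le.
by rewrite /c' ifN //; lia.
Qed.

(** As a (y^-1 + c) + b = (a^-1 y)^-1 + (a c + b), the scalar moves inwards and is inverted at each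
    level. *)
Lemma carlitz_rep_affine (p : nat) (g : 'F_p -> 'F_p) (n : nat)
    (c : nat -> 'F_p) (a b : 'F_p) :
  a != 0 -> carlitz_rep g n c ->
  exists c', carlitz_rep (fun x => a * g x + b) n c'.
Proof.
move=> a0 g_rep.
(* The last constant is tracked because one level up it is interior and has to be nonzero. *)
suff [c' []] : exists c', carlitz_rep (fun x => a * g x + b) n c' /\
    c' n.+1 = a * c n.+1 + b by exists c'.
case: g_rep => c0 c_neq0 gE.
elim: n g a b a0 c_neq0 gE => [|n IHn] g a b a0 c_neq0 gE.
  exists (fun i => if i == 0%N then a * c 0%N else a * c 1%N + b).
  split=> //; split=> [|i|x]; rewrite /= ?mulf_neq0 //; first by lia.
  by rewrite gE /=; ring.
have ai0 : a^-1 != 0 by rewrite invr_eq0.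
have c_neq0' i : (2 <= i <= n)%N -> c i != 0 by move=> ?; apply: c_neq0; lia.
have [c' [[c'0 c'_neq0 c'E] c'_last]] :=
  IHn (carlitz_chain c n) a^-1 0 ai0 c_neq0' (fun=> erefl).
pose c'' i := if i == n.+2 then a * c n.+2 + b else c' i.
exists c''; split; last by rewrite /c'' eqxx.
split=> // [i i_range|x].
  rewrite /c'' ifN; last by lia.
  case: (eqVneq i n.+1) => [i_eq|]; last by move=> ?; apply: c'_neq0; lia.
  by rewrite i_eq c'_last addr0 mulf_neq0 // c_neq0 //; lia.
rewrite gE /= {2}/c'' eqxx mulrDr -addrA; congr (_ + _).
rewrite (@eq_carlitz_chain _ c'' c') => [|i i_le]; last by rewrite /c'' ifN //; lia.
by rewrite -c'E addr0 invfM invrK.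
Qed.

Definition carlitz_representable (p : nat) (g : 'F_p -> 'F_p) : Prop :=
  exists n c, carlitz_rep g n c.

Lemma eq_carlitz_representable (p : nat) (g h : 'F_p -> 'F_p) :
  g =1 h -> carlitz_representable g -> carlitz_representable h.
Proof.
move=> gh [n [c [c0 c_neq0 gE]]]; exists n, c; split=> // x.
by rewrite -gh.
Qed.

(* With [d = b - a], the transposition of [a] and [b] is
   [z |-> - d^2 (((z - b)^-1 + d^-1)^-1 - d)^-1 + a]. *)
Lemma carlitz_representable_tperm (p : nat) (g : 'F_p -> 'F_p) (a b : 'F_p) :
  a != b -> carlitz_representable g ->
  carlitz_representable (tperm a b \o g).
Proof.
move=> ab g_rep; pose d := b - a.
have d0 : d != 0 by rewrite subr_eq0 eq_sym.
have aff (h : 'F_p -> 'F_p) u v : u != 0 -> carlitz_representable h ->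
    carlitz_representable (fun x => u * h x + v).
  move=> u0 [n [c /(carlitz_rep_affine v u0)[c' h_rep]]].
  by exists n, c'.
have inv (h : 'F_p -> 'F_p) : carlitz_representable h -> carlitz_representable (fun x => (h x)^-1).
  by move=> [n [c /carlitz_rep_inv]].
have d2 : - d ^+ 2 != 0 by rewrite oppr_eq0 expf_neq0.
have h1 := aff _ 1 (- b) (oner_neq0 _) g_rep.
have h2 := inv _ (aff _ 1 d^-1 (oner_neq0 _) (inv _ h1)).
have := aff _ (- d ^+ 2) a d2 (inv _ (aff _ 1 (- d) (oner_neq0 _) h2)).
apply: eq_carlitz_representable => x /=; rewrite !mul1r.
(* At [a] the second inversion meets 0, at [b] the first and the third do, and [0^-1 = 0] produces
   the swap; elsewhere the Moebius maps compose to the identity. *)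
set y := g x; case: tpermP => [->|->|/eqP ya /eqP yb].
- have -> : a - b = - d by rewrite /d opprB.
  by rewrite invrN addNr invr0 sub0r; rewrite /d in d0 *; field; rewrite ?oppr_eq0.
- by rewrite subrr invr0 add0r invrK subrr invr0 mulr0 add0r.
have yb0 : y - b != 0 by rewrite subr_eq0.
have ya0 : y - a != 0 by rewrite subr_eq0.
have -> : (y - b)^-1 + d^-1 = (y - a) / (d * (y - b)).
  by rewrite /d in d0 *; field; rewrite yb0.
have -> : ((y - a) / (d * (y - b)))^-1 - d = - d ^+ 2 / (y - a).
  by rewrite /d in d0 *; field; rewrite ?yb0 ?ya0 ?d0.
rewrite /d in d0 *; field; rewrite ?yb0 ?ya0 ?d0 /=.
by rewrite oppr_eq0 expf_neq0.
Qed.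

(** Carlitz's theorem: starting from the identity, a chain without inversions, the transpositions
    that make up the permutation are composed one by one. *)
Lemma carlitz_representable_inj (p : nat) (g : 'F_p -> 'F_p) :
  injective g -> carlitz_representable g.
Proof.
move=> g_inj; have [ts g_ts ts_neq] := prod_tpermP (perm g_inj).
apply: (@eq_carlitz_representable _ (perm g_inj \o id)) => [x|].
  by rewrite /= permE.
have : carlitz_representable (id : 'F_p -> 'F_p).
  exists 0%N, (fun i => if i == 0%N then 1 else 0).
  split=> [|i|x]; rewrite /= ?oner_eq0 ?mul1r ?addr0 //; lia.
rewrite {}g_ts; elim: ts ts_neq (id) => [|[a b] ts IHts] /=.
  move=> _ h; rewrite big_nil.
  by apply: eq_carlitz_representable => x /=; rewrite perm1.
case/andP=> ab /IHts{}IHts h /(carlitz_representable_tperm ab)/IHts.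
by apply: eq_carlitz_representable => x /=; rewrite big_cons permM.
Qed.

Lemma carlitz_chain_inj (p : nat) (c : nat -> 'F_p) (n : nat) :
  c 0%N != 0 -> injective (carlitz_chain c n).
Proof.
move=> c0; elim: n => [|n IHn] x y /=.
  by move/addIr/(mulfI c0).
by move/addIr/invr_inj/IHn.
Qed.

(* One exceptional point is added at each inversion: the zero of the chain so
   far. *)
Lemma carlitz_chain_moebius (p : nat) (c : nat -> 'F_p) (n : nat) :
  c 0%N != 0 ->
  exists al be ga de : 'F_p, exists2 E : {set 'F_p},
    (#|E| <= n)%N & al * de - be * ga != 0 /\
    forall x, x \notin E ->
      carlitz_chain c n x * (ga * x + de) = al * x + be.
Proof.
move=> c0; elim: n => [|n [al [be [ga [de [E E_le [det_neq0 chainE]]]]]]].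
  exists (c 0%N), (c 1%N), 0, 1, set0; first by rewrite cards0.
  by split=> [|x _]; rewrite ?mulr0 ?subr0 ?mulr1 //= mul0r add0r mulr1.
pose g := carlitz_chain c n; pose t := c n.+2.
exists (ga + t * al), (de + t * be), al, be, (E :|: [set x | g x == 0]).
  apply: leq_trans (leq_card_setU _ _) _; rewrite -[n.+1]addn1 leq_add //.
  apply/card_le1_eqP=> x y; rewrite !inE => /eqP gx /eqP gy.
  by apply: (carlitz_chain_inj (n := n) c0); rewrite -/g gx.
split=> [|x].
  rewrite (_ : _ - _ = - (al * de - be * ga)) ?oppr_eq0 //; ring.
rewrite !inE negb_or => /andP[/chainE gE g0] /=; rewrite -/g -/t.
by rewrite mulrDl -{1}gE mulKf //; ring.
Qed.

Lemma discrete_log_inj (p : nat) (xi : 'F_p) (f : {poly 'F_p}) :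
  prime p -> (p.-1).-primitive_root xi -> f.[0] = 0 ->
  (forall i, (i < p.-1)%N -> f.[xi ^+ i] = i.+1%:R) ->
  injective (horner f).
Proof.
move=> p_pr xi_prim f0 fxi.
have log x : x != 0 -> exists2 i, (i < p.-1)%N & x = xi ^+ i.
  exact: prim_root_Fp_log.
have f_neq0 x : x != 0 -> f.[x] != 0.
  move=> /log[i i_lt ->]; rewrite fxi // Fp_small_natr_neq0 //; lia.
move=> x y; have [->|x0] := eqVneq x 0; have [->|y0] := eqVneq y 0 => //.
- by rewrite f0 => /esym/eqP; rewrite (negbTE (f_neq0 y y0)).
- by rewrite f0 => /eqP; rewrite (negbTE (f_neq0 x x0)).
have [i i_lt ->] := log x x0; have [j j_lt ->] := log y y0.
rewrite !fxi // => /(congr1 (@nat_of_ord _)); rewrite !val_Fp_nat //.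
by rewrite !modn_small; try lia; case=> ->.
Qed.

(** Off at most [n] points [f] agrees with a Moebius map. If 0 is exceptional, all p - n agreements
    are hits. If not, one agreement is lost at 0, but [f.[0] = 0] forces [be = 0], where the sharper
    bound on hits makes up for it. *)
Lemma Crk_bound (p : nat) (xi : 'F_p) (f : {poly 'F_p}) :
  prime p -> (3 < p)%N -> (p.-1).-primitive_root xi -> f.[0] = 0 ->
  (forall i, (i < p.-1)%N -> f.[xi ^+ i] = i.+1%:R) ->
  ((p - Crk f - 1) ^ 2 < 4 * (p - 2))%N.
Proof.
move=> p_pr p_gt3 xi_prim f0 fxi.
have f_inj : injective (horner f) by exact: discrete_log_inj xi_prim f0 fxi.
have [[c [c0 _ fE]] _] := leastP (carlitz_representable_inj f_inj).
rewrite -[least _]/(Crk f) in fE; move: (Crk f) fE => n fE.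
have [al [be [ga [de [E E_le [det_neq0 chainE]]]]]] := carlitz_chain_moebius n c0.
have fE_hit x : x \notin E -> f.[x] * (ga * x + de) = al * x + be.
  by rewrite fE; exact: chainE.
have hits_V := card_moebius_values al be ga de p_pr xi_prim fxi.
move: hits_V; set V := [set x | _] => hits_V.
have E_compl : (p - n <= #|~: E|)%N.
  by have := cardsC E; rewrite card_Fp //; lia.
have E0_compl : (#|~: E :\ 0%R| <= #|V|)%N.
  apply/subset_leq_card/subsetP=> x; rewrite !inE => /andP[-> /fE_hit->].
  by rewrite eqxx.
rewrite (cardsD1 (0%R : 'F_p) (~: E)) inE in E_compl.
have := leq_trans E0_compl hits_V; move: #|_ :\ _| E_compl => k.
have [E0 /= nk kN|E0 /= nk kN] := boolP (0%R \in E).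
  have := moebius_hits_bound p_pr (ltnW p_gt3) xi_prim det_neq0.
  apply: leq_ltn_trans; rewrite leq_sqr -[leqRHS]subn1 leq_sub2r //.
  exact: leq_trans nk kN.
have be0 : be = 0 by have := fE_hit 0 E0; rewrite f0 mul0r mulr0 add0r.
rewrite be0 mul0r subr0 in det_neq0; rewrite be0 in kN.
have := moebius0_hits_bound ga p_pr p_gt3 xi_prim det_neq0.
apply: leq_ltn_trans; rewrite leq_sqr; apply: leq_trans kN.
by rewrite leq_subLR.
Qed.

(** * Degree, weight, index and the three estimates together *)

Theorem theorem3 (R : rcfType) (p : nat) (p_prime : prime p) (p_gt2 : (2 < p)%N)
    (xi : 'F_p) (xi_prim : (p.-1).-primitive_root xi)
    (f : {poly 'F_p}) (deg_f : ((size f).-1 <= p.-1)%N) (f0 : f.[0] = 0)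
    (fxi : forall i : nat, (i <= p - 2)%N -> f.[xi ^+ i] = (i + 1)%:R) :
  [/\ (size f).-1 = (p - 2)%N /\ weight f = (p - 2)%N,
      (3 < p)%N -> Ind xi f = p.-1,
      (3 < p)%N ->
        (linearity f)%:R < Num.sqrt (2 * (p%:R - 2)) + 1 :> R,
      (invertibility f)%:R < 2 * Num.sqrt (p%:R - 2) + 1 :> R &
      (3 < p)%N ->
        (Crk f)%:R > p%:R - 2 * Num.sqrt (p%:R - 2) - 1 :> R].
Proof.
have f_log i : (i < p.-1)%N -> f.[xi ^+ i] = i.+1%:R.
  by move=> i_lt; rewrite fxi ?addn1 //; lia.
have -> : p%:R - 2 = (p - 2)%:R :> R by rewrite natrB // ltnW.
split.
- have sz_f : (size f <= p)%N by lia.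
  have [f_0 f_last f_neq0] :=
    discrete_log_poly_coefs p_prime p_gt2 xi_prim sz_f f0 f_log.
  have p2S : (p - 2).+1 = p.-1 by lia.
  have sz_f' : (size f <= (p - 2).+2)%N by lia.
  have p2_gt0 : (0 < p - 2)%N by lia.
  have f_last' : f`_(p - 2).+1 = 0 by rewrite p2S.
  have f_mid j : (0 < j <= p - 2)%N -> f`_j != 0.
    by move=> j_range; apply: f_neq0; lia.
  by have [-> ->] := size_weight_from_coefs sz_f' f_0 f_last' p2_gt0 f_mid.
- by move=> p_gt3; apply: Ind_discrete_log.
- move=> p_gt3; rewrite -natrM; apply/ltr_nat_pred/ltr_nat_sqrt.
  apply: (linearity_bound p_prime xi_prim f_log) => [|a a0]; first by lia.
  exact: linear_hits_bound.
- apply/ltr_nat_pred/ltr_nat_double_sqrt.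
  apply: (invertibility_bound p_prime xi_prim f_log) => [|c c0]; first by lia.
  by apply: moebius_hits_bound => //; rewrite mul0r sub0r mulr1 oppr_eq0.
- move=> p_gt3; have := ltr_nat_double_sqrt R (Crk_bound p_prime p_gt3 xi_prim f0 f_log).
  (* This form survives truncated subtraction, whatever the size of [Crk f]. *)
  have : p%:R <= (p - Crk f - 1 + Crk f + 1)%:R :> R by rewrite ler_nat; lia.
  by rewrite !natrD; lra.
Qed.
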